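(* Let $R$ be a commutative ring with identity whose set of zero-divisors $Z_R$ satisfies $Z_R\ne\{0\}$, and let $n>1$. Then the orthogonality graph $O(M_n(R))$ is connected and has diameter $3$ or $4$. Its diameter equals $3$ if and only if $$\forall a_0\in Z_R\ \ \exists a_1,a_2\in R\setminus\{0\}\ \ \forall i,j\in\{0,1,2\},\ i\ne j:\ a_ia_j=0.$$ Moreover, every vertex of $O(M_n(R))$ is at distance at most $2$ from some scalar matrix $bE$, $b\in R$, that is itself a vertex of $O(M_n(R))$.
   Context: All rings are associative with identity. For a commutative ring $R$, $Z_R=\{a\in R:\ ax=0\text{ for some }x\ne0\}$ is the set of zero-divisors (it contains $0$). For a ring $S$, an element $x$ is a two-sided zero-divisor if there exist nonzero $y,z\in S$ with $xy=0$ and $zx=0$. The orthogonality graph $O(S)$ is the undirected graph whose vertices are the nonzero two-sided zero-divisors of $S$, with distinct vertices $x,y$ adjacent iff $xy=yx=0$. Distance $d(x,y)$ is the minimal length of a path (infinite if none); the diameter is the supremum of all distances. $E$ denotes the identity matrix; $M_n(R)$ is the ring of $n\times n$ matrices over $R$. *)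

(* Defs.v *)
From HB Require Import structures.
From mathcomp Require Import all_boot all_order all_algebra.
Set Implicit Arguments. Unset Strict Implicit. Unset Printing Implicit Defensive.
Import GRing.Theory.
Local Open Scope ring_scope.

Definition zero_divisor (R : comNzRingType) (a : R) : Prop :=
  exists x : R, x != 0 /\ a * x = 0.

Definition two_sided_zd (S : pzRingType) (x : S) : Prop :=
  exists y z : S, [/\ y != 0, z != 0, x * y = 0 & z * x = 0].

Definition og_vertex (S : pzRingType) (x : S) : Prop :=
  x != 0 /\ two_sided_zd x.

Definition og_adj (S : pzRingType) (x y : S) : Prop :=
  [/\ og_vertex x, og_vertex y, x != y, x * y = 0 & y * x = 0].

Inductive og_walk (S : pzRingType) : S -> S -> nat -> Prop :=
| og_walk0 x : og_vertex x -> og_walk x x 0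
| og_walkS x y z m : og_adj x y -> og_walk y z m -> og_walk x z m.+1.

Definition og_dist_le (S : pzRingType) (x y : S) (k : nat) : Prop :=
  exists2 m, (m <= k)%N & og_walk x y m.

Definition og_connected (S : pzRingType) : Prop :=
  forall x y : S, og_vertex x -> og_vertex y -> exists m, og_walk x y m.

Definition og_diam_le (S : pzRingType) (k : nat) : Prop :=
  forall x y : S, og_vertex x -> og_vertex y -> og_dist_le x y k.

(* diameter of O(S) equals k (k >= 1): sup of distances is exactly k. *)
Definition og_diam_eq (S : pzRingType) (k : nat) : Prop :=
  og_diam_le S k /\ ~ og_diam_le S k.-1.

(* Main.v *)
(** By McCoy's theorem a matrix is a zero-divisor iff its determinant is.  The
quantitative form used here: if [x != 0] kills [\det A], let [r] be the largest
size of a minor not killed by [x]; then [x] times the adjugate of a bordered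
[(r+1)]-minor, placed back in ['M_n], is a nonzero two-sided annihilator of [A]
with all entries in [x R].  Annihilators with entries in [x R] and [y R] are
orthogonal when [x * y = 0], and scalar matrices [b%:M] with [b * x = 0] are
orthogonal to the former; this bounds all the distances.  For the lower bounds,
[1 - (1 - a) P] with [P] a rank one idempotent has only the annihilators [t P],
[a * t = 0]; two such matrices, for idempotents [P], [Q] with [P Q = Q],
are at distance at least 3, and a path of length 3 between them is a pair
[t], [s] of orthogonal annihilators of [a]. *)

Require Import Defs.
From HB Require Import structures.
From mathcomp Require Import all_boot all_order all_algebra.
From Stdlib Require Import Classical.
Local Open Scope ring_scope.

Import GRing.Theory.

(** * Orthogonal pairs and short walks *)

Definition ortho (S : pzRingType) (x y : S) : Prop := x * y = 0 /\ y * x = 0.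

Lemma ortho_sym {S : pzRingType} {x y : S} : ortho S x y -> ortho S y x.
Proof. by case. Qed.

Lemma ortho_vertex {S : pzRingType} {x y : S} :
  x != 0 -> y != 0 -> ortho S x y -> og_vertex x.
Proof. by move=> x0 y0 [xy yx]; split=> //; exists y, y. Qed.

Lemma dist_le_refl {S : pzRingType} {x : S} : og_vertex x -> og_dist_le x x 0.
Proof. by move=> vx; exists 0%N => //; constructor. Qed.

(** Adjacency demands distinct vertices; when [x = y] the step is simply dropped, so paths can be
    built from orthogonality alone. *)
Lemma dist_le_ortho {S : pzRingType} {x y z : S} {k : nat} :
  ortho S x y -> x != 0 -> y != 0 -> og_dist_le y z k -> og_dist_le x z k.+1.
Proof.
move=> oxy x0 y0 [m le_mk w].
have [exy|nxy] := eqVneq x y; first by exists m; [exact: leqW | rewrite exy].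
exists m.+1 => //; apply: og_walkS w; have [xy yx] := oxy; split=> //.
  exact: ortho_vertex oxy.
exact: ortho_vertex (ortho_sym oxy).
Qed.

Lemma dist_le_weaken {S : pzRingType} {x y : S} {k l : nat} :
  (k <= l)%N -> og_dist_le x y k -> og_dist_le x y l.
Proof. by move=> le_kl [m /leq_trans/(_ le_kl) le_ml w]; exists m. Qed.

Lemma walk_le3 {S : pzRingType} {x z : S} {m : nat} :
  og_walk x z m -> (m <= 3)%N ->
  [\/ x = z, x * z = 0,
      exists y : S, [/\ y != 0, ortho S x y & ortho S y z] |
      m = 3%N /\ exists y1 y2 : S, [/\ y1 != 0, y2 != 0 &
        [/\ ortho S x y1, ortho S y1 y2 & ortho S y2 z]]].
Proof.
case=> {x z m} [x _ | x y z m [_ [y0 _] _ xy yx] w]; first by constructor 1.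
case: w xy yx y0 => {y z m} [y _ | y1 y2 z m [_ [y20 _] _ y12 y21] w] xy yx y0.
  by constructor 2.
case: w y12 y21 y20 => {y2 z m} [y2 _ | y2 y3 z m [_ _ _ y23 y32] w] y12 y21 y20.
  by constructor 3; exists y1.
case: w y23 y32 => {y3 z m} [y3 _ | y3 y4 z m _ _] y23 y32 //.
by constructor 4; split=> //; exists y1, y2.
Qed.

(** * Annihilators from bordered minors *)

Lemma mx_neq0P {R : comNzRingType} {m n : nat} {A : 'M[R]_(m, n)} :
  A != 0 -> exists i j, A i j != 0.
Proof.
move=> A0; have [/existsP[i /existsP[j]]|] := boolP [exists i, exists j, A i j != 0].
  by exists i, j.
move=> /existsPn nA; case/eqP: A0; apply/matrixP=> i j; rewrite mxE.
by move/existsPn: (nA i) => /(_ j) /negbNE /eqP.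
Qed.

Definition lift_minor {R : comNzRingType} {n r : nat} (A : 'M[R]_n)
    (f g : 'I_r.+1 -> 'I_n) : 'M[R]_n :=
  colsub g 1%:M *m \adj (mxsub f g A) *m rowsub f 1%:M.

Lemma tr_lift_minor {R : comNzRingType} {n r : nat} (A : 'M[R]_n)
    (f g : 'I_r.+1 -> 'I_n) :
  (lift_minor A f g)^T = lift_minor A^T g f.
Proof.
by rewrite /lift_minor !trmx_mul trmx_adj !trmx_mxsub trmx1 mulmxA.
Qed.

(** By row expansion, entry [(k, b)] of [A *m colsub g 1%:M *m \adj (mxsub f g A)] is the minor with
    row [f b] replaced by row [k]. Row selectors need not be injective, so this is again some
    [mxsub f' g A]. *)
Lemma mul_lift_minor {R : comNzRingType} {n r : nat} (A : 'M[R]_n) (x : R)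
    (f g : 'I_r.+1 -> 'I_n) :
  (forall f' g' : 'I_r.+1 -> 'I_n, x * \det (mxsub f' g' A) = 0) ->
  A *m (x *: lift_minor A f g) = 0.
Proof.
move=> kill; rewrite /lift_minor -scalemxAr !mulmxA scalemxAl.
suff ->: x *: (A *m colsub g 1%:M *m \adj (mxsub f g A)) = 0 by rewrite mul0mx.
rewrite mulmx_colsub mulmx1; apply/matrixP=> k b; rewrite !mxE.
pose f' i := if i == b then k else f i.
rewrite -[RHS](kill f' g) (expand_det_row _ b); congr (_ * _).
apply: eq_bigr => a _; rewrite !mxE /f' eqxx; congr (_ * _).
rewrite /cofactor; congr (_ * \det _); apply/matrixP=> i j; rewrite !mxE.
by rewrite /f' eq_sym (negPf (neq_lift b i)).
Qed.

Definition border {r n : nat} (i0 : 'I_n) (f : 'I_r -> 'I_n) (i : 'I_r.+1) :=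
  if unlift ord0 i is Some j then f j else i0.

Lemma border0 {r n : nat} (i0 : 'I_n) (f : 'I_r -> 'I_n) : border i0 f ord0 = i0.
Proof. by rewrite /border unlift_none. Qed.

Lemma border_lift {r n : nat} (i0 : 'I_n) (f : 'I_r -> 'I_n) (i : 'I_r) :
  border i0 f (lift ord0 i) = f i.
Proof. by rewrite /border liftK. Qed.

(** Since [f] and [g] miss [i0] and [j0], only index [ord0] reaches this entry, which is thus the
    corner cofactor of the bordered minor. *)
Lemma lift_minor_border {R : comNzRingType} {n r : nat} (A : 'M[R]_n)
    (f g : 'I_r -> 'I_n) (i0 j0 : 'I_n) :
  i0 \notin codom f -> j0 \notin codom g ->
  lift_minor A (border i0 f) (border j0 g) j0 i0 = \det (mxsub f g A).
Proof.
move=> i0f j0g; rewrite mxE (bigD1 ord0) //= big1 => [|i].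
  rewrite addr0 !mxE border0 eqxx mulr1 (bigD1 ord0) //= big1 => [|j].
    rewrite addr0 !mxE border0 eqxx mul1r /cofactor expr0 mul1r.
    by congr (\det _); apply/matrixP=> i j; rewrite !mxE !border_lift.
  case: (unliftP ord0 j) => [j' ->|->]; last by rewrite eqxx.
  move=> _; rewrite !mxE border_lift; case: eqP => [e|]; last by rewrite mul0r.
  by rewrite e codom_f in j0g.
case: (unliftP ord0 i) => [i' ->|->]; last by rewrite eqxx.
move=> _; rewrite 2![X in _ * X]mxE border_lift.
case: eqP => [e|]; last by rewrite mulr0.
by rewrite -e codom_f in i0f.
Qed.

Lemma codom_ord_ex {r n : nat} (f : 'I_r -> 'I_n) :
  (r < n)%N -> exists i, i \notin codom f.
Proof.
move=> lt_rn; have [/forallP all_f|/forallPn//] := boolP [forall i, i \in codom f].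
have: (#|'I_n| <= #|codom f|)%N by apply/subset_leq_card/subsetP=> i _.
by move/leq_trans/(_ (card_size _)); rewrite size_codom !card_ord leqNgt lt_rn.
Qed.

Lemma mccoy {R : comNzRingType} {n : nat} (A : 'M[R]_n) (x : R) :
  x != 0 -> x * \det A = 0 ->
  exists Y : 'M[R]_n, x *: Y != 0 /\ ortho _ A (x *: Y).
Proof.
move=> x0 xA.
pose K r := forall f g : 'I_r -> 'I_n, x * \det (mxsub f g A) = 0.
have K0 : ~ K 0%N.
  have h : 'I_0 -> 'I_n by case.
  by move/(_ h h)/eqP; rewrite det_mx00 mulr1; apply/negP.
(* Every n-minor is a product with [\det A] as a factor. *)
have Kn : K n.
  move=> f g; rewrite -[A]mulmx1 mxsub_mul rowsubE !det_mulmx.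
  by rewrite mulrA [x * _]mulrCA xA mulr0 mul0r.
have [r [lt_rn nKr Kr1]] : exists r, [/\ (r < n)%N, ~ K r & K r.+1].
  apply: NNPP => nex; suff: forall r, (r <= n)%N -> ~ K r by move/(_ n (leqnn n)).
  elim=> // r IHr lt_rn Kr1; apply: nex; exists r; split=> //.
  exact/IHr/ltnW.
have [f [g nfg]] : exists f g : 'I_r -> 'I_n, x * \det (mxsub f g A) != 0.
  apply: NNPP => nex; apply: nKr => f g; apply/eqP; apply: contraT => nfg.
  by case: nex; exists f, g.
have [i0 i0f] := codom_ord_ex f lt_rn; have [j0 j0g] := codom_ord_ex g lt_rn.
exists (lift_minor A (border i0 f) (border j0 g)); split.
  apply: contraNneq nfg => /matrixP/(_ j0 i0).
  by rewrite mxE lift_minor_border // [in RHS]mxE => ->.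
split; first exact: mul_lift_minor.
(* Transposition swaps [f] and [g] and reduces the left annihilator to the right one. *)
apply: trmx_inj; rewrite trmx_mul linearZ /= tr_lift_minor trmx0.
apply: mul_lift_minor => f' g'.
by rewrite -[RHS](Kr1 g' f') -trmx_mxsub det_tr.
Qed.

(** * Upper bounds on distances *)

Lemma det_vertex {R : comNzRingType} {n : nat} {A : 'M[R]_n} :
  og_vertex A -> zero_divisor (\det A).
Proof.
case=> _ [Y [_ [/mx_neq0P[i [j Yij]] _ AY _]]]; exists (Y i j); split=> //.
have: \det A *: Y = 0.
  by rewrite -mul_scalar_mx -mul_adj_mx -mulmxA (AY : A *m Y = 0) mulmx0.
by move/matrixP/(_ i j); rewrite !mxE.
Qed.

Lemma ortho_scale {R : comNzRingType} {n : nat} (x y : R) (Y Z : 'M[R]_n) :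
  x * y = 0 -> ortho _ (x *: Y) (y *: Z).
Proof.
move=> xy; split; first by rewrite -[LHS]scalemxAl -scalemxAr scalerA xy scale0r.
by rewrite -[LHS]scalemxAl -scalemxAr scalerA mulrC xy scale0r.
Qed.

Lemma scalar_mx_neq0 {R : comNzRingType} {n : nat} (b : R) :
  (0 < n)%N -> b != 0 -> b%:M != 0 :> 'M[R]_n.
Proof.
case: n => // n _; apply: contra_neq => /matrixP/(_ ord0 ord0).
by rewrite !mxE eqxx.
Qed.

Lemma dist_le3 {R : comNzRingType} {n : nat} {A C : 'M[R]_n} {u v : R} :
  og_vertex A -> og_vertex C -> u != 0 -> v != 0 ->
  u * \det A = 0 -> v * \det C = 0 -> u * v = 0 -> og_dist_le A C 3.
Proof.
move=> vA vC u0 v0 uA vC0 uv.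
have [Y [Y0 oAY]] := mccoy A u u0 uA; have [Z [Z0 oCZ]] := mccoy C v v0 vC0.
apply: (dist_le_ortho oAY vA.1 Y0 _).
apply: (dist_le_ortho (ortho_scale u v Y Z uv) Y0 Z0 _).
apply: (dist_le_ortho (ortho_sym oCZ) Z0 vC.1 _).
exact: dist_le_refl.
Qed.

(** For [p != 0] take [y = p]; for [p = 0] the pair comes from the nonzero zero-divisor of [R]. *)
Lemma zero_divisor_neq0_ann {R : comNzRingType} (p : R) :
  (exists a : R, a != 0 /\ zero_divisor a) -> zero_divisor p ->
  exists x y : R, [/\ x != 0, y != 0, x * p = 0 & x * y = 0].
Proof.
move=> [a [a0 [b [b0 ab]]]] [x [x0 px]].
have [p0|p0] := eqVneq p 0; last by exists x, p; rewrite mulrC.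
by exists a, b; rewrite p0 mulr0.
Qed.

Lemma dist_le_scalar {R : comNzRingType} {n : nat} {A : 'M[R]_n} {x b : R} :
  (0 < n)%N -> og_vertex A -> x != 0 -> b != 0 -> x * \det A = 0 -> x * b = 0 ->
  og_vertex (b%:M : 'M[R]_n) /\ og_dist_le A b%:M 2.
Proof.
move=> n0 vA x0 b0 xA xb; have [Y [Y0 oAY]] := mccoy A x x0 xA.
have B0 := scalar_mx_neq0 (n := n) b n0 b0.
have oYB : ortho _ (x *: Y) b%:M by rewrite -scalemx1; apply: ortho_scale.
have vB := ortho_vertex B0 Y0 (ortho_sym oYB); split=> //.
apply: (dist_le_ortho oAY vA.1 Y0 _); apply: (dist_le_ortho oYB Y0 B0 _).
exact: dist_le_refl.
Qed.

Lemma diam_le4 {R : comNzRingType} {n : nat} :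
  (exists a : R, a != 0 /\ zero_divisor a) -> (0 < n)%N ->
  og_diam_le [the pzRingType of 'M[R]_n] 4.
Proof.
move=> hZ n0 A C vA vC.
have [x [b [x0 b0 xA xb]]] := zero_divisor_neq0_ann _ hZ (det_vertex vA).
have [y [_ [y0 _ yC _]]] := zero_divisor_neq0_ann _ hZ (det_vertex vC).
(* If [x * y] is nonzero it kills both determinants and [b], so the path runs through [b%:M]. *)
have [xy|xy] := eqVneq (x * y) 0.
  exact: dist_le_weaken (dist_le3 vA vC x0 y0 xA yC xy).
have xyA : x * y * \det A = 0 by rewrite mulrAC xA mul0r.
have xyC : x * y * \det C = 0 by rewrite -mulrA yC mulr0.
have xyb : x * y * b = 0 by rewrite mulrAC xb mul0r.
have [Y [Y0 oAY]] := mccoy A _ xy xyA; have [Z [Z0 oCZ]] := mccoy C _ xy xyC.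
have B0 := scalar_mx_neq0 (n := n) b n0 b0.
have oYB : ortho _ (x * y *: Y) b%:M by rewrite -scalemx1; apply: ortho_scale.
have oZB : ortho _ (x * y *: Z) b%:M by rewrite -scalemx1; apply: ortho_scale.
apply: (dist_le_ortho oAY vA.1 Y0 _); apply: (dist_le_ortho oYB Y0 B0 _).
apply: (dist_le_ortho (ortho_sym oZB) B0 Z0 _).
apply: (dist_le_ortho (ortho_sym oCZ) Z0 vC.1 _); exact: dist_le_refl.
Qed.

(** * Annihilator pairs in [R] and perturbed idempotents *)

Definition ann_pair (R : comNzRingType) (a0 : R) : Prop :=
  exists a1 a2 : R, [/\ a1 != 0, a2 != 0, a0 * a1 = 0, a0 * a2 = 0 & a1 * a2 = 0].

(** If [p * q * y = 0] but [q * y != 0], then [q * y] annihilates [p] and is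
orthogonal to every annihilator of [q]; symmetrically for [p * y].  Otherwise
the annihilators of [p * q] kill both [p] and [q]. *)
Lemma ann_pair_mul {R : comNzRingType} (p q : R) :
  zero_divisor p -> zero_divisor q -> ann_pair R (p * q) ->
  exists u v : R, [/\ u != 0, v != 0, u * p = 0, v * q = 0 & u * v = 0].
Proof.
move=> [x [x0 px]] [z [z0 qz]] [y1 [y2 [y10 y20 pqy1 pqy2 y12]]].
have left y : p * q * y = 0 -> q * y != 0 -> exists u v : R,
    [/\ u != 0, v != 0, u * p = 0, v * q = 0 & u * v = 0].
  move=> pqy qy; exists (q * y), z; split=> //; first by rewrite mulrC mulrA.
    by rewrite mulrC.
  by rewrite mulrAC qz mul0r.
have right y : p * q * y = 0 -> p * y != 0 -> exists u v : R,
    [/\ u != 0, v != 0, u * p = 0, v * q = 0 & u * v = 0].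
  move=> pqy py; exists x, (p * y); split=> //; first by rewrite mulrC.
    by rewrite mulrAC.
  by rewrite mulrA [x * p]mulrC px mul0r.
have [py1|/(right _ pqy1)//] := eqVneq (p * y1) 0.
have [qy2|/(left _ pqy2)//] := eqVneq (q * y2) 0.
by exists y1, y2; split; rewrite // mulrC.
Qed.

(** For idempotent [P] this acts as [a] on the image of [P] and as the identity on its kernel. *)
Definition pert {R : comNzRingType} {n : nat} (a : R) (P : 'M[R]_n) : 'M[R]_n :=
  1%:M - (1 - a) *: P.

Lemma tr_pert {R : comNzRingType} {n : nat} (a : R) (P : 'M[R]_n) :
  (pert a P)^T = pert a P^T.
Proof. by rewrite /pert linearB /= linearZ /= trmx1. Qed.

Lemma pert_ann {R : comNzRingType} {n : nat} {a : R} {P X : 'M[R]_n} :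
  P *m P = P -> pert a P *m X = 0 -> P *m X = X /\ a *: X = 0.
Proof.
move=> PP; rewrite /pert mulmxBl mul1mx -scalemxAl => /subr0_eq eX.
have ePX : P *m X = (1 - a) *: (P *m X).
  by rewrite {1}eX -scalemxAr mulmxA PP.
split; first by rewrite ePX -eX.
move: ePX; rewrite -eX => PX; move: eX; rewrite PX scalerBl scale1r.
by move/eqP; rewrite eq_sym subr_eq addrC -subr_eq subrr eq_sym => /eqP.
Qed.

Lemma ann_pert {R : comNzRingType} {n : nat} {a : R} {P X : 'M[R]_n} :
  P *m P = P -> X *m pert a P = 0 -> X *m P = X.
Proof.
move=> PP Xp; apply: trmx_inj; rewrite trmx_mul.
by apply: (pert_ann (a := a) _ _).1; rewrite -?tr_pert -trmx_mul ?PP ?Xp ?trmx0.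
Qed.

Lemma delta_corner {R : comNzRingType} {n : nat} (i : 'I_n) (X : 'M[R]_n) :
  delta_mx i i *m X *m delta_mx i i = X i i *: delta_mx i i.
Proof.
rewrite -(mul_delta_mx (0 : 'I_1)) !mulmxA -(mulmxA (delta_mx i 0)) -rowE.
rewrite -(mulmxA (delta_mx i 0)) -colE [col _ _]mx11_scalar !mxE.
by rewrite mul_mx_scalar -scalemxAl.
Qed.

(** * Lower bounds from two rank one idempotents *)

Section Idempotents.
Context {R : comNzRingType} {n : nat} (i j : 'I_n) (hij : j != i).

Let P : 'M[R]_n := delta_mx i i.
(** [Q] has the same column space as [P] but a different row space. *)
Let Q : 'M[R]_n := delta_mx i i + delta_mx i j.

Let PP : P *m P = P. Proof. exact: mul_delta_mx. Qed.
Let PQ : P *m Q = Q. Proof. by rewrite mulmxDr !mul_delta_mx. Qed.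
Let QP : Q *m P = P.
Proof. by rewrite mulmxDl mul_delta_mx mul_delta_mx_0 ?addr0. Qed.
Let QQ : Q *m Q = Q. Proof. by rewrite -{2}PQ mulmxA QP PQ. Qed.

Let ji : (j == i) = false := negPf hij.
Let ij : (i == j) = false. Proof. by rewrite eq_sym ji. Qed.

Lemma pert_vertex (a : R) (S : 'M[R]_n) :
  zero_divisor a -> S *m S = S -> S j j = 0 -> S i i = 1 -> og_vertex (pert a S).
Proof.
move=> [t [t0 at0]] SS Sjj Sii.
apply: (@ortho_vertex _ _ (t *: S)).
- apply: contra_neq (oner_neq0 R) => /matrixP/(_ j j).
  by rewrite !mxE eqxx Sjj mulr0 subr0.
- by apply: contra_neq t0 => /matrixP/(_ i i); rewrite !mxE Sii mulr1.
have eP : S - (1 - a) *: S = a *: S by rewrite scalerBl scale1r opprB addrC subrK.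
split; rewrite -[LHS]/(_ *m _) /pert.
  rewrite mulmxBl mul1mx -scalemxAl -scalemxAr SS [_ *: (t *: _)]scalerA.
  by rewrite mulrC -scalerA -scalerBr eP scalerA mulrC at0 scale0r.
rewrite mulmxBr mulmx1 -scalemxAl -scalemxAr SS -scalerBr eP.
by rewrite scalerA mulrC at0 scale0r.
Qed.

Lemma pertP_vertex (a : R) : zero_divisor a -> og_vertex (pert a P).
Proof.
by move=> za; apply: pert_vertex => //; rewrite !mxE ?ji ?eqxx.
Qed.

Lemma pertQ_vertex (a : R) : zero_divisor a -> og_vertex (pert a Q).
Proof.
by move=> za; apply: pert_vertex => //; rewrite !mxE ?ji ?ij ?eqxx /= ?addr0.
Qed.

Lemma pert_walk (a : R) (m : nat) :
  zero_divisor a -> og_walk (pert a P) (pert a Q) m -> (m <= 3)%N ->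
  m = 3%N /\ ann_pair R a.
Proof.
move=> [x [x0 ax]] w le_m3.
have [e|e|[y [y0 [py yp] [yq qy]]]|[-> [X [Y [X0 Y0]]]]] := walk_le3 w le_m3.
(* Length 0: the [(i, j)] entries force [a = 1], not a zero-divisor. *)
- move/matrixP/(_ i j): e; rewrite !mxE ij !eqxx ji /= !(mulr0, add0r, mulr1, oppr0).
  move/esym/eqP; rewrite oppr_eq0 subr_eq0 => /eqP a1.
  by rewrite -a1 mul1r in ax; rewrite ax eqxx in x0.
(* Length 1: [pert a Q] has [(j, j)] entry 1, but row [j] of [P] vanishes. *)
- have [/matrixP/(_ j j) + _] := pert_ann PP e.
  rewrite !mxE !eqxx ji !add0r mulr0 subr0 big1 => [/esym/eqP|k _].
    by rewrite oner_eq0.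
  by rewrite mxE ji mul0r.
(* Length 2: the middle vertex is a multiple of [P] fixed by right multiplication by [Q], hence
   zero. *)
- have [Py _] := pert_ann PP py; have yP := ann_pert PP yp.
  have yQ := ann_pert QQ yq.
  have ey : y = y i i *: P by rewrite -delta_corner Py yP.
  move: yQ; rewrite ey -scalemxAl PQ => /matrixP/(_ i j).
  rewrite !mxE !eqxx ji /= add0r mulr1 mulr0 => yii.
  by rewrite ey yii scale0r eqxx in y0.
case=> -[pX Xp] [XY _] [Yq qY]; split=> //.
have [PX aX] := pert_ann PP pX; have XP := ann_pert PP Xp.
have [QY aY] := pert_ann QQ qY; have YQ := ann_pert QQ Yq.
have eX : X = X i i *: P by rewrite -delta_corner PX XP.
have PY : P *m Y = Y by rewrite -QY mulmxA PQ.
(* [Y = Y Q = (P Y P) Q], and [P Y P] is [Y i i] times [P]. *)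
have eY : Y = Y i i *: Q
  by rewrite -[in LHS]YQ -PQ mulmxA -PY delta_corner -scalemxAl PY.
have Qii : Q i i = 1 by rewrite !mxE eqxx ij addr0.
exists (X i i), (Y i i); split.
- by apply: contra_neq X0 => xii; rewrite eX xii scale0r.
- by apply: contra_neq Y0 => yii; rewrite eY yii scale0r.
- by move/matrixP/(_ i i): aX; rewrite !mxE.
- by move/matrixP/(_ i i): aY; rewrite !mxE.
move: XY; rewrite -[X * Y]/(X *m Y) {1}eX {1}eY -scalemxAl -scalemxAr PQ scalerA.
by move/matrixP/(_ i i); rewrite mxE Qii mulr1 mxE.
Qed.

End Idempotents.

(** Serves twice: [k = 2] is contradictory, and [k = 3] yields the annihilator pair. *)
Lemma diam_le_ann_pair {R : comNzRingType} {n : nat} {a : R} {k : nat} :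
  (1 < n)%N -> (k <= 3)%N -> og_diam_le [the pzRingType of 'M[R]_n] k ->
  zero_divisor a -> (2 < k)%N /\ ann_pair R a.
Proof.
case: n => [|[|n]] // _ le_k3 diam za; have h : lift ord0 ord0 != ord0 :> 'I_n.+2 by [].
have [m le_mk w] := diam _ _ (pertP_vertex _ _ h a za) (pertQ_vertex _ _ h a za).
have [em pa] := pert_walk _ _ h a m za w (leq_trans le_mk le_k3).
by rewrite -em.
Qed.

Theorem theorem1 (R : comNzRingType) (n : nat)
  (hZ : exists a : R, a != 0 /\ zero_divisor a) (hn : (1 < n)%N) :
  [/\ og_connected [the pzRingType of 'M[R]_n],
      og_diam_eq [the pzRingType of 'M[R]_n] 3 \/
        og_diam_eq [the pzRingType of 'M[R]_n] 4,
      og_diam_eq [the pzRingType of 'M[R]_n] 3 <->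
        (forall a0 : R, zero_divisor a0 ->
           exists a1 a2 : R, [/\ a1 != 0, a2 != 0,
             (a0 * a1 = 0 /\ a1 * a0 = 0),
             (a0 * a2 = 0 /\ a2 * a0 = 0) &
             (a1 * a2 = 0 /\ a2 * a1 = 0)])
    & forall A : 'M[R]_n, og_vertex A ->
        exists b : R, og_vertex (b%:M : 'M[R]_n) /\ og_dist_le A (b%:M) 2].
Proof.
have n0 : (0 < n)%N := ltnW hn.
have d4 : og_diam_le [the pzRingType of 'M[R]_n] 4 := diam_le4 hZ n0.
have nd2 : ~ og_diam_le [the pzRingType of 'M[R]_n] 2.
  have [a [_ za]] := hZ; move=> d2.
  by have [] := diam_le_ann_pair (k := 2) hn isT d2 za.
split.
- by move=> A C vA vC; have [m _ w] := d4 A C vA vC; exists m.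
- have [d3|nd3] := classic (og_diam_le [the pzRingType of 'M[R]_n] 3).
    by left.
  by right.
- split=> [[d3 _] a za|pairs].
    have [_ [a1 [a2 [a10 a20 aa1 aa2 a12]]]] := diam_le_ann_pair (k := 3) hn isT d3 za.
    by exists a1, a2; rewrite [a1 * a]mulrC [a2 * a]mulrC [a2 * a1]mulrC.
  split=> // A C vA vC; have [zA zC] := (det_vertex vA, det_vertex vC).
  (* The condition is applied to the product of the determinants, and [ann_pair_mul] then splits the
     pair between [A] and [C]. *)
  have zAC : zero_divisor (\det A * \det C).
    by have [x [x0 Ax]] := zA; exists x; rewrite mulrAC Ax mul0r.
  have pAC : ann_pair R (\det A * \det C).
    have [a1 [a2 [a10 a20 [aa1 _] [aa2 _] [a12 _]]]] := pairs _ zAC.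
    by exists a1, a2.
  have [u [v [u0 v0 uA vC0 uv]]] := ann_pair_mul _ _ zA zC pAC.
  exact: dist_le3 vA vC u0 v0 uA vC0 uv.
move=> A vA; have [x [b [x0 b0 xA xb]]] := zero_divisor_neq0_ann _ hZ (det_vertex vA).
by exists b; apply: dist_le_scalar x0 b0 xA xb.
Qed.
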